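(* Fix $a<0$ and constants $0<\underline c\le\overline c$, $0<\underline d\le\overline d$, $\underline D\le\overline D$. For each integer $N\ge2$ consider the energy sharing game (defined in the context) with prosumers $\mathcal{I}=\{1,\dots,N\}$, price sensitivity $a$, and parameters satisfying $\underline c\le c_i\le\overline c$, $\underline d\le d_i\le\overline d$, $\underline D\le D_i\le\overline D$ for all $i\in\mathcal{I}$. Let $(p^*(N),b^*(N))$ be its unique Nash equilibrium, and let $\bar p(N)$ be the socially optimal solution, i.e. the unique optimal solution of $$\min_{p\in\mathbb{R}^N}\ \sum_{i=1}^N(c_ip_i^2+d_ip_i)\quad\text{s.t.}\quad\sum_{i=1}^Np_i=\sum_{i=1}^ND_i .$$ Then $$\sum_{i\in\mathcal{I}}f_i(p_i^*(N))\ \ge\ \sum_{i\in\mathcal{I}}f_i(\bar p_i(N))$$ for every $N$, and the average cost difference satisfies $$\lim_{N\to\infty}\frac1N\left[\sum_{i\in\mathcal{I}}f_i(p_i^*(N))-\sum_{i\in\mathcal{I}}f_i(\bar p_i(N))\right]=0 .$$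
   Context: Energy sharing game. The players (prosumers) are $\mathcal{I}=\{1,\dots,N\}$. Prosumer $i$ has a required load reduction $D_i\in\mathbb{R}$ and disutility function $f_i(p_i)=c_ip_i^2+d_ip_i$ with $c_i,d_i>0$. The common price sensitivity is $a<0$. Each prosumer $i$ chooses an output adjustment $p_i\in\mathbb{R}$ and a bid $b_i\in\mathbb{R}$. Given the bids $b=(b_1,\dots,b_N)$, the sharing price is $\lambda_c(b)=-\frac{1}{Na}\sum_{j=1}^N b_j$ (equivalently, the market clears: $\sum_i(a\lambda_c+b_i)=0$). Given the other bids $b_{-i}$, prosumer $i$ minimizes $$\Pi_i(p_i,b_i,b_{-i})=c_ip_i^2+d_ip_i+(a\lambda_c(b)+b_i)\lambda_c(b)$$ over the action set $X_i(b_{-i})=\{(p_i,b_i)\in\mathbb{R}^2:\ p_i+a\lambda_c(b)+b_i=D_i\}$. A profile $(p^*,b^* )$ is a Nash equilibrium if for every $i$, $(p_i^*,b_i^* )\in X_i(b_{-i}^* )$ and $\Pi_i(p_i^*,b_i^*,b_{-i}^* )\le\Pi_i(p_i,b_i,b_{-i}^* )$ for all $(p_i,b_i)\in X_i(b_{-i}^* )$. This game has exactly one Nash equilibrium. *)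

(* Defs.v *)
From HB Require Import structures.
From mathcomp Require Import all_boot all_order all_algebra.
From mathcomp Require Import all_classical all_reals all_analysis.

Set Implicit Arguments.
Unset Strict Implicit.
Unset Printing Implicit Defensive.

Import Order.TTheory GRing.Theory Num.Theory.
Import numFieldNormedType.Exports.

Local Open Scope classical_set_scope.
Local Open Scope ring_scope.

Definition disutility (R : realType) (c d p : R) : R := c * p ^+ 2 + d * p.

Definition sharing_price (R : realType) (N : nat) (a : R) (b : 'I_N -> R) : R :=
  - (N%:R * a)^-1 * \sum_j b j.

(* An action of a prosumer is a pair x = (p_i, b_i).  In [action_set] and
   [prosumer_cost], b is a full bid profile of which only the bids b_{-i} of
   the others matter: its i-th entry is overwritten by x.2. *)
Definition action_set (R : realType) (N : nat) (a : R) (D : 'I_N -> R)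
    (i : 'I_N) (b : 'I_N -> R) : set (R * R) :=
  [set x | x.1 + a * sharing_price a [eta b with i |-> x.2] + x.2 = D i].

Definition prosumer_cost (R : realType) (N : nat) (a : R) (c d : 'I_N -> R)
    (i : 'I_N) (b : 'I_N -> R) (x : R * R) : R :=
  let lambda := sharing_price a [eta b with i |-> x.2] in
  disutility (c i) (d i) x.1 + (a * lambda + x.2) * lambda.

Definition nash_equilibrium (R : realType) (N : nat) (a : R)
    (c d D : 'I_N -> R) (p b : 'I_N -> R) : Prop :=
  forall i : 'I_N,
    action_set a D i b (p i, b i) /\
    forall x : R * R, action_set a D i b x ->
      prosumer_cost a c d i b (p i, b i) <= prosumer_cost a c d i b x.

Definition total_disutility (R : realType) (N : nat) (c d p : 'I_N -> R) : R :=
  \sum_i disutility (c i) (d i) (p i).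

Definition balanced (R : realType) (N : nat) (D : 'I_N -> R) :
    set ('I_N -> R) :=
  [set p | \sum_i p i = \sum_i D i].

Definition social_optimum (R : realType) (N : nat) (c d D : 'I_N -> R)
    (p : 'I_N -> R) : Prop :=
  balanced D p /\
  forall q : 'I_N -> R, balanced D q ->
    total_disutility c d p <= total_disutility c d q.

(* Main.v *)
Require Import Defs.
From HB Require Import structures.
From mathcomp Require Import all_boot all_order all_algebra.
From mathcomp Require Import all_classical all_reals all_analysis.
From mathcomp Require Import ring lra.

Import Order.TTheory GRing.Theory Num.Theory.
Import numFieldNormedType.Exports.

Local Open Scope classical_set_scope.
Local Open Scope ring_scope.

(** The equilibrium sits close to the optimum because the only distortion in a
prosumer's first-order condition is the effect of its own bid on the price, of
order [1 / N].

Write [lam] for the equilibrium price and [q i := D i - p i] for the energy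
that prosumer [i] buys.  Market clearing says [\sum_i q i = 0], so the
equilibrium outputs are feasible for the social problem: this is the first
claim.  For the second one, when prosumer [i] raises its output by [s], its bid
has to move so that the price becomes [lam + s / ((N - 1) * a)]; stationarity
of its cost then reads [f_i' (p i) = lam + e i] with
[e i := - q i / ((N - 1) * a)] (lemma [nash_first_order]).  Socially optimal
outputs would have all marginal disutilities equal, and [e i] measures the
failure of this.

The failure costs little.  Since [f_i] is a quadratic with leading coefficient
at least [cmin], replacing [p] by any balanced [r] saves at most
[\sum_i (e i ^+ 2) / (4 * cmin)] ([saving_le_wedges]).  So it suffices that the
[q i] are bounded in mean square, uniformly in [N].  Multiplying the
first-order conditions by [q i] and summing eliminates the price, as
[\sum_i q i = 0]; what is left says that moving from [p] towards [D] does
not decrease total disutility to first order, and strong convexity turns this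
into [\sum_i q i ^+ 2 <= N * K] with [K] depending only on the bounds of the
parameters ([nash_trade_mean_square]).  The average gap is thus
[O(1 / (N - 1) ^+ 2)]. *)

(** * Quadratic estimates *)

Section Quadratics.
Variable R : realType.
Implicit Types (c k g s x y : R).

(** The test point is the minimizer [- g / (2 * k)]. *)
Lemma quadratic_ge0_linear_eq0 k g :
  0 < k -> (forall s, 0 <= g * s + k * s ^+ 2) -> g = 0.
Proof.
move=> k_gt0 /(_ (- g / (2 * k))).
have -> : g * (- g / (2 * k)) + k * (- g / (2 * k)) ^+ 2
          = - (g ^+ 2 / (4 * k)) by field; rewrite gt_eqF.
rewrite oppr_ge0 pmulr_lle0 ?invr_gt0; last by lra.
by move=> g2_le0; apply/eqP; rewrite -sqrf_eq0 eq_le g2_le0 sqr_ge0.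
Qed.

Lemma weighted_young k x y : 0 < k -> x * y <= x ^+ 2 / (4 * k) + k * y ^+ 2.
Proof.
move=> k_gt0; rewrite -subr_ge0.
have -> : x ^+ 2 / (4 * k) + k * y ^+ 2 - x * y = (x - 2 * k * y) ^+ 2 / (4 * k).
  by field; rewrite gt_eqF.
by rewrite mulr_ge0 ?sqr_ge0 // invr_ge0; lra.
Qed.

(** At [y] the quadratic exceeds its tangent at [x] by [c * (x - y) ^+ 2], which
absorbs the contribution [e * (x - y)] of the part [e] of the slope.  The part
[lam] is kept apart because, as a common price, it cancels in a sum over
balanced profiles. *)
Lemma disutility_sub_le c k d lam e x y : 0 < k -> k <= c ->
  2 * c * x + d = lam + e ->
  disutility c d x - disutility c d y <= lam * (x - y) + e ^+ 2 / (4 * k).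
Proof.
move=> k_gt0 kc slope; have young := weighted_young k e (x - y) k_gt0.
have -> : disutility c d x - disutility c d y
          = lam * (x - y) + e * (x - y) - c * (x - y) ^+ 2.
  rewrite -mulrDl -slope /disutility; ring.
have := ler_wpM2r (sqr_ge0 (x - y)) kc; lra.
Qed.

End Quadratics.

(** * The first-order condition of an equilibrium *)

Section Game.
Variables (R : realType) (N : nat) (a : R).
Hypotheses (a_lt0 : a < 0) (N_ge2 : (2 <= N)%N).
Implicit Types (b c d D p r : 'I_N -> R) (i : 'I_N).

Local Notation n := (N%:R : R).

Let n_gt1 : 1 < n. Proof. by rewrite ltr1n. Qed.
Let n_neq0 : n != 0. Proof. by rewrite gt_eqF // (lt_trans _ n_gt1). Qed.
Let n1_gt0 : 0 < n - 1. Proof. by rewrite subr_gt0. Qed.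
Let n1_neq0 : n - 1 != 0. Proof. by rewrite gt_eqF. Qed.
Let a_neq0 : a != 0. Proof. by rewrite lt_eqF. Qed.

Lemma sharing_price_update b i y :
  sharing_price a [eta b with i |-> y] = sharing_price a b - (y - b i) / (n * a).
Proof.
rewrite /sharing_price (bigD1 i) //= eqxx [\sum_j b j](bigD1 i) //=.
rewrite (eq_bigr b) => [|j /negPf ->] //.
by field; rewrite n_neq0 a_neq0.
Qed.

Lemma market_clearing b : \sum_i (a * sharing_price a b + b i) = 0.
Proof.
rewrite big_split /= sumr_const card_ord -mulr_natl /sharing_price.
by field; rewrite n_neq0 a_neq0.
Qed.

Section Equilibrium.
Variables (c d D p b : 'I_N -> R).
Hypothesis nash : nash_equilibrium a c d D p b.

Lemma nash_trade i : D i - p i = a * sharing_price a b + b i.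
Proof.
have [] := nash i; rewrite /action_set /= sharing_price_update subrr mul0r subr0.
by move=> <- _; ring.
Qed.

Lemma nash_trade_sum : \sum_i (D i - p i) = 0.
Proof. by under eq_bigr do rewrite nash_trade; exact: market_clearing. Qed.

Lemma nash_balanced : balanced D p.
Proof. by have /eqP := nash_trade_sum; rewrite sumrB subr_eq0 => /eqP. Qed.

(** The bid enters both the price and the traded quantity, so the deviation is
parametrized by the change [s] of output; the bid that keeps the action
feasible is then [b i - s * N / (N - 1)], and it moves the price by
[s / ((N - 1) * a)]. *)
Lemma nash_first_order i : 0 < c i ->
  2 * c i * p i + d i = sharing_price a b - (D i - p i) / ((n - 1) * a).
Proof.
move=> c_gt0; apply/eqP; rewrite -subr_eq0; apply/eqP.
have na_lt0 : (n - 1) * a < 0 by rewrite pmulr_rlt0.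
apply: (@quadratic_ge0_linear_eq0 _ (c i - ((n - 1) * a)^-1)).
  by rewrite subr_gt0 (lt_trans _ c_gt0) // invr_lt0.
move=> s; have [_] := nash i.
pose y := b i - s * n / (n - 1).
have price_y : sharing_price a [eta b with i |-> y]
               = sharing_price a b + s / ((n - 1) * a).
  rewrite sharing_price_update /y; field; by rewrite n_neq0 n1_neq0 a_neq0.
have trade_y : a * sharing_price a [eta b with i |-> y] + y = D i - p i - s.
  rewrite price_y nash_trade /y; field; by rewrite n1_neq0 a_neq0.
have feasible : action_set a D i b (p i + s, y).
  by rewrite /action_set /= -addrA trade_y; ring.
move=> /(_ _ feasible); rewrite /prosumer_cost /= trade_y price_y.
rewrite sharing_price_update subrr mul0r subr0 -nash_trade -subr_ge0.
congr (0 <= _); rewrite /disutility; field; by rewrite n1_neq0 a_neq0.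
Qed.

(** * Bounds on trade and on the loss of efficiency *)

Variable k : R.
Hypotheses (k_gt0 : 0 < k) (c_ge : forall i, k <= c i).

Let c_gt0 i : 0 < c i. Proof. exact: lt_le_trans (c_ge i). Qed.

(** Summed over the prosumers, the price is multiplied by
[\sum_i (p i - r i)], which vanishes because both profiles are balanced. *)
Lemma saving_le_wedges r : balanced D r ->
  total_disutility c d p - total_disutility c d r
    <= \sum_i ((D i - p i) / ((n - 1) * a)) ^+ 2 / (4 * k).
Proof.
move=> bal_r; rewrite -sumrB.
have le_i i : true -> disutility (c i) (d i) (p i) - disutility (c i) (d i) (r i)
    <= sharing_price a b * (p i - r i)
       + ((D i - p i) / ((n - 1) * a)) ^+ 2 / (4 * k).
  (* The wedge of the first-order condition is the opposite of the one squared
     here. *)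
  move=> _; rewrite -sqrrN; apply: disutility_sub_le => //.
  exact: nash_first_order.
apply: le_trans (ler_sum (index_enum _) le_i) _; rewrite big_split /= -mulr_sumr sumrB.
by rewrite nash_balanced bal_r subrr mulr0 add0r.
Qed.

(** The first-order conditions are tested against the trades [D i - p i].  The
price drops out, since the trades sum to zero, and the market-power term
contributes [- (D i - p i) ^+ 2 / ((N - 1) * a) >= 0], which is discarded.
In the remaining inequality [2 * c i] times the squared trade competes with the
marginal disutility at [p = D] times the trade; by Young's inequality half of
the former absorbs the latter up to a constant. *)
Lemma nash_trade_mean_square G :
  (forall i, (2 * c i * D i + d i) ^+ 2 <= G) ->
  \sum_i (D i - p i) ^+ 2 <= n * (G / (4 * k ^+ 2)).
Proof.
move=> G_ge.
have le_i i : true -> sharing_price a b * (D i - p i)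
    <= G / (4 * k) - k * (D i - p i) ^+ 2.
  move=> _; set q := D i - p i.
  have foc := nash_first_order i (c_gt0 i).
  have slope : sharing_price a b = (2 * c i * D i + d i) - 2 * c i * q
                                   + q / ((n - 1) * a).
    by rewrite /q; lra.
  have wedge_le0 : q / ((n - 1) * a) * q <= 0.
    rewrite mulrAC -expr2 mulr_ge0_le0 ?sqr_ge0 // invr_le0 ltW //.
    by rewrite pmulr_rlt0.
  have young := weighted_young R k (2 * c i * D i + d i) q k_gt0.
  have G_i : (2 * c i * D i + d i) ^+ 2 / (4 * k) <= G / (4 * k).
    by rewrite ler_pM2r ?G_ge // invr_gt0 mulr_gt0.
  have cq := ler_wpM2r (sqr_ge0 q) (c_ge i).
  have -> : sharing_price a b * q = (2 * c i * D i + d i) * q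
      - 2 * (c i * q ^+ 2) + q / ((n - 1) * a) * q by rewrite slope; ring.
  lra.
have := ler_sum (index_enum _) le_i; rewrite -mulr_sumr nash_trade_sum mulr0 sumrB sumr_const.
rewrite card_ord -mulr_sumr -[_ *+ N]mulr_natl subr_ge0 => sum_le.
rewrite -(ler_pM2l k_gt0); apply: le_trans sum_le _.
suff -> : k * (n * (G / (4 * k ^+ 2))) = n * (G / (4 * k)) by [].
by field; rewrite gt_eqF.
Qed.

Lemma nash_average_gap_le G r :
  (forall i, (2 * c i * D i + d i) ^+ 2 <= G) -> balanced D r ->
  n^-1 * (total_disutility c d p - total_disutility c d r)
    <= G / (16 * k ^+ 3 * a ^+ 2) / (n - 1) ^+ 2.
Proof.
move=> G_ge bal_r; rewrite ler_pdivrMl; last by rewrite (lt_trans _ n_gt1).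
apply: le_trans (saving_le_wedges r bal_r) _.
pose w := ((n - 1) * a) ^- 2 / (4 * k).
have w_ge0 : 0 <= w.
  by rewrite /w mulr_ge0 ?invr_ge0 ?sqr_ge0 // mulr_ge0 // ltW.
have -> : \sum_i ((D i - p i) / ((n - 1) * a)) ^+ 2 / (4 * k)
          = (\sum_i (D i - p i) ^+ 2) * w.
  by rewrite mulr_suml; apply: eq_bigr => i _; rewrite exprMn exprVn /w mulrA.
apply: le_trans (ler_wpM2r w_ge0 (nash_trade_mean_square G G_ge)) _.
rewrite le_eqVlt; apply/orP; left; apply/eqP; rewrite /w.
by field; rewrite a_neq0 n1_neq0 gt_eqF.
Qed.

End Equilibrium.

End Game.

(** * Large numbers of prosumers *)

(** At [N = 2] this is an equality, which fixes the constant [3]. *)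
Lemma inv_pred_sqr_le_harmonic (R : realType) (N : nat) : (2 <= N)%N ->
  (N%:R - 1 : R) ^- 2 <= 3 * harmonic N.
Proof.
move=> N_ge2; have n_ge2 : 2 <= N%:R :> R by rewrite ler_nat.
rewrite /harmonic /= -(natr1 N) ler_pdivlMr; last by lra.
rewrite mulrC ler_pdivrMr; last by rewrite exprn_gt0 // subr_gt0; lra.
nra.
Qed.

Theorem proposition4 (R : realType) (a cmin cmax dmin dmax Dmin Dmax : R)
    (ha : a < 0)
    (hcmin : 0 < cmin) (hcmax : cmin <= cmax)
    (hdmin : 0 < dmin) (hdmax : dmin <= dmax)
    (hD : Dmin <= Dmax)
    (c d D : forall N : nat, 'I_N -> R)
    (hbounds : forall N : nat, (2 <= N)%N -> forall i : 'I_N,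
       [/\ cmin <= c N i <= cmax, dmin <= d N i <= dmax
         & Dmin <= D N i <= Dmax])
    (pstar bstar pbar : forall N : nat, 'I_N -> R)
    (hnash : forall N : nat, (2 <= N)%N ->
       nash_equilibrium a (c N) (d N) (D N) (pstar N) (bstar N))
    (hopt : forall N : nat, (2 <= N)%N ->
       social_optimum (c N) (d N) (D N) (pbar N)) :
  (forall N : nat, (2 <= N)%N ->
     total_disutility (c N) (d N) (pstar N)
       >= total_disutility (c N) (d N) (pbar N)) /\
  (fun N : nat => N%:R^-1 *
     (total_disutility (c N) (d N) (pstar N)
        - total_disutility (c N) (d N) (pbar N))) @ \oo --> (0 : R).
Proof.
have optimal N (N_ge2 : (2 <= N)%N) : total_disutility (c N) (d N) (pbar N)
                              <= total_disutility (c N) (d N) (pstar N).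
  have [_] := hopt N N_ge2; apply; exact: nash_balanced ha N_ge2 _ _ _ _ _ (hnash N N_ge2).
split=> //.
(* [B] bounds the required load reductions in absolute value, so [G] bounds the
squared marginal disutilities at [p = D], uniformly in [N]. *)
pose B := `|Dmin| + `|Dmax|.
pose G := (2 * cmax * B + dmax) ^+ 2.
have G_ge N (N_ge2 : (2 <= N)%N) i : (2 * c N i * D N i + d N i) ^+ 2 <= G.
  have [/andP[c1 c2] /andP[d1 d2] /andP[D1 D2]] := hbounds N N_ge2 i.
  have D_B : `|D N i| <= B.
    rewrite ler_norml /B; have := ler_norm Dmax; have := lerNnormlW (lexx `|Dmin|).
    have := normr_ge0 Dmax; have := normr_ge0 Dmin; lra.
  rewrite -real_normK ?num_real // ler_sqr ?nnegrE //; last first.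
    by rewrite addr_ge0 ?mulr_ge0 ?(le_trans _ D_B) //; lra.
  rewrite (le_trans (ler_normD _ _)) // lerD //; last by rewrite ger0_norm; lra.
  by rewrite normrM ler_pM // ger0_norm; lra.
pose C := G / (16 * cmin ^+ 3 * a ^+ 2).
have C_ge0 : 0 <= C.
  have cmin_ge0 := ltW hcmin.
  by rewrite /C divr_ge0 ?sqr_ge0 // mulr_ge0 ?sqr_ge0 // mulr_ge0 // exprn_ge0.
have gap_le N (N_ge2 : (2 <= N)%N) :
    N%:R^-1 * (total_disutility (c N) (d N) (pstar N)
               - total_disutility (c N) (d N) (pbar N)) <= C * 3 * harmonic N.
  have c_ge i : cmin <= c N i by have [/andP[]] := hbounds N N_ge2 i.
  have [bal _] := hopt N N_ge2.
  rewrite -mulrA.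
  apply: le_trans (ler_wpM2l C_ge0 (inv_pred_sqr_le_harmonic R N N_ge2)).
  exact: (nash_average_gap_le R N a ha N_ge2 _ _ _ _ _ (hnash N N_ge2) cmin
            hcmin c_ge G _ (G_ge N N_ge2) bal).
apply: (@squeeze_cvgr _ _ _ _ (cst 0) (fun N => C * 3 * harmonic N)).
- near=> N.
  have N_ge2 : (2 <= N)%N by near: N; exact: nbhs_infty_ge.
  by rewrite gap_le // andbT mulr_ge0 // subr_ge0 optimal.
- exact: cvg_cst.
- rewrite -[X in _ --> X](mulr0 (C * 3)); apply: cvgMr; exact: cvg_harmonic.
Unshelve. all: by end_near.
Qed.
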